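(* Let the setting, Assumption A and Assumption B below hold, with agents and data sampled without replacement, and let $w_i$ be generated by the ISFedAvg algorithm below. Define the incremental noise $$q_i=\frac1L\sum_{\ell\in\mathcal{L}_i}\frac{1}{Kp_\ell E_\ell B_\ell}\sum_{e=1}^{E_\ell}\sum_{b\in\mathcal{B}_{\ell,e}}\frac{1}{N_\ell p_b^{(\ell)}}\Big(\nabla_w Q_\ell(w_{\ell,e-1};x_{\ell,b})-\nabla_w Q_\ell(w_{i-1};x_{\ell,b})\Big).$$ Then $$\mathbb{E}\|q_i\|^2\le O(\mu)\,\mathbb{E}\|\widetilde w_{i-1}\|^2+O(\mu)\,\xi^2+O(\mu^2)\frac1K\sum_{k=1}^K\sigma_{q,k}^2,$$ where $\widetilde w_{i-1}=w^o-w_{i-1}$, $\sigma_{q,k}^2=\frac{3}{B_kN_k^2}\sum_{n=1}^{N_k}\frac{1}{p_n^{(k)}}\|\nabla_wQ_k(w_k^o;x_{k,n})\|^2$, and the constants implicit in the $O(\cdot)$ terms depend on the epoch sizes, local convergence rates, numbers of data samples, number of agents, Lipschitz constant, and the data and agent normalized inclusion probabilities. In particular $\mathbb{E}\|q_i\|^2=O(\mu)$.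
   Context: There are $K$ agents; agent $k$ holds data points $x_{k,1},\dots,x_{k,N_k}$, a loss $Q_k(w;x)$ differentiable in $w\in\mathbb{R}^M$, and the empirical risk $P_k(w)=\frac1{N_k}\sum_{n=1}^{N_k}Q_k(w;x_{k,n})$. Let $w^o=\arg\min_w\frac1K\sum_kP_k(w)$ and $w_k^o=\arg\min_wP_k(w)$. Assumption A: each $P_k$ is $\nu$-strongly convex ($\nu>0$), each $Q_k(\cdot;x_{k,n})$ is convex with $\delta$-Lipschitz gradient. Assumption B: $\|w_k^o-w^o\|\le\xi$ for all $k$. ISFedAvg with step-size $\mu>0$: at iteration $i$, select $L$ agents $\mathcal{L}_i$ from $\{1,\dots,K\}$ without replacement with $\mathbb{P}(k\in\mathcal{L}_i)=Lp_k$ ($p_k>0$, $\sum_kp_k=1$); each $k\in\mathcal{L}_i$ sets $w_{k,0}=w_{i-1}$ and for $e=1,\dots,E_k$ draws a mini-batch $\mathcal{B}_{k,e}$ of $B_k$ indices from $\{1,\dots,N_k\}$ without replacement with $\mathbb{P}(n\in\mathcal{B}_{k,e})=B_kp_n^{(k)}$ ($p_n^{(k)}>0$, $\sum_np_n^{(k)}=1$), independently of the past, and updates $w_{k,e}=w_{k,e-1}-\frac{\mu}{Kp_kE_kB_k}\sum_{b\in\mathcal{B}_{k,e}}\frac{1}{N_kp_b^{(k)}}\nabla_wQ_k(w_{k,e-1};x_{k,b})$; then $w_i=\frac1L\sum_{k\in\mathcal{L}_i}w_{k,E_k}$. The notation $O(\mu^a)$ denotes a term bounded by $C\mu^a$ for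 a constant $C$ independent of $\mu$ and $i$, for sufficiently small $\mu$. *)

(* Defs.v *)
From HB Require Import structures.
From mathcomp Require Import all_boot all_order all_algebra.
From mathcomp Require Import all_classical all_reals all_analysis.
Set Implicit Arguments. Unset Strict Implicit. Unset Printing Implicit Defensive.
Import Order.TTheory GRing.Theory Num.Theory.
Import numFieldNormedType.Exports.
Local Open Scope ring_scope.

Section ISFedAvg.
Variable (R : realType) (M : nat).
Notation vec := 'rV[R]_M.

Definition dotv (u v : vec) : R := \sum_(j < M) u 0 j * v 0 j.
Definition sqnorm (v : vec) : R := dotv v v.
Definition enorm (v : vec) : R := Num.sqrt (sqnorm v).

Definition grad (f : vec -> R) (w : vec) : vec :=
  \row_(j < M) derive f w (delta_mx 0 j : vec).

Definition convex_fun (f : vec -> R) : Prop :=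
  forall (x y : vec) (t : R), 0 <= t <= 1 ->
    f (t *: x + (1 - t) *: y) <= t * f x + (1 - t) * f y.

Definition strongly_convex (nu : R) (f : vec -> R) : Prop :=
  forall (x y : vec) (t : R), 0 <= t <= 1 ->
    f (t *: x + (1 - t) *: y)
      <= t * f x + (1 - t) * f y - nu / 2 * t * (1 - t) * sqnorm (x - y).

(* K agents; agent k has N k data points; the loss at data point n of agent k
   is Q k n : vec -> R, i.e. Q_k(. ; x_{k,n}). *)

Definition emp_risk (K : nat) (N : 'I_K -> nat)
  (Q : forall k : 'I_K, 'I_(N k) -> vec -> R) (k : 'I_K) (w : vec) : R :=
  (N k)%:R^-1 * \sum_(n < N k) Q k n w.

Definition agg_risk (K : nat) (N : 'I_K -> nat)
  (Q : forall k : 'I_K, 'I_(N k) -> vec -> R) (w : vec) : R :=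
  K%:R^-1 * \sum_(k < K) emp_risk Q k w.

(* a sampling design without replacement: a probability distribution on the
   subsets of 'I_n, supported on subsets of size m, with first order
   inclusion probabilities P(j \in S) = m * p j *)
Definition sampling_design (n m : nat) (p : 'I_n -> R) (pi : {set 'I_n} -> R)
  : Prop :=
  [/\ forall S, 0 <= pi S,
      \sum_(S : {set 'I_n}) pi S = 1,
      forall S, pi S != 0 -> #|S| = m &
      forall j : 'I_n, \sum_(S : {set 'I_n} | j \in S) pi S = m%:R * p j].

(* batch used at local step e+1 (e : nat, 0 <= e < Ek) *)
Definition batch_at (Ek Nk : nat) (bs : {ffun 'I_Ek -> {set 'I_Nk}}) (e : nat)
  : {set 'I_Nk} :=
  oapp bs finset.set0 (insub e).

Definition local_iter (K : nat) (N E B : 'I_K -> nat)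
  (Q : forall k : 'I_K, 'I_(N k) -> vec -> R)
  (p : 'I_K -> R) (pd : forall k : 'I_K, 'I_(N k) -> R) (mu : R)
  (k : 'I_K) (w : vec) (bs : {ffun 'I_(E k) -> {set 'I_(N k)}}) : nat -> vec :=
  fix it (e : nat) : vec :=
  match e with
  | 0 => w
  | e'.+1 =>
      let we := it e' in
      we - (mu / (K%:R * p k * (E k)%:R * (B k)%:R)) *:
             \sum_(b in batch_at bs e') ((N k)%:R * pd k b)^-1 *: grad (Q k b) we
  end.

(* the incremental noise q_i, for current iterate w_{i-1} = w, selected agent
   set S = L_i, and batches bb k e = B_{k,e+1} *)
Definition incr_noise (K L : nat) (N E B : 'I_K -> nat)
  (Q : forall k : 'I_K, 'I_(N k) -> vec -> R)
  (p : 'I_K -> R) (pd : forall k : 'I_K, 'I_(N k) -> R) (mu : R)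
  (w : vec) (S : {set 'I_K})
  (bb : {dffun forall k : 'I_K, {ffun 'I_(E k) -> {set 'I_(N k)}}}) : vec :=
  L%:R^-1 *: \sum_(l in S)
    (K%:R * p l * (E l)%:R * (B l)%:R)^-1 *:
      \sum_(e < E l) \sum_(b in bb l e)
        ((N l)%:R * pd l b)^-1 *:
          (grad (Q l b) (local_iter B Q p pd mu w (bb l) e) - grad (Q l b) w).

(* expectation over the sampling of iteration i (agent selection with design
   piA, batches drawn independently with designs piB k), given w_{i-1} = w *)
Definition iter_expect (K : nat) (N E : 'I_K -> nat)
  (piA : {set 'I_K} -> R) (piB : forall k : 'I_K, {set 'I_(N k)} -> R)
  (F : {set 'I_K} ->
       {dffun forall k : 'I_K, {ffun 'I_(E k) -> {set 'I_(N k)}}} -> R) : R :=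
  \sum_(S : {set 'I_K})
    \sum_(bb : {dffun forall k : 'I_K, {ffun 'I_(E k) -> {set 'I_(N k)}}})
      piA S * (\prod_(k < K) \prod_(e < E k) piB k (bb k e)) * F S bb.

Definition sigma_q2 (K : nat) (N B : 'I_K -> nat)
  (Q : forall k : 'I_K, 'I_(N k) -> vec -> R)
  (pd : forall k : 'I_K, 'I_(N k) -> R) (wko : 'I_K -> vec) (k : 'I_K) : R :=
  3 / ((B k)%:R * (N k)%:R ^+ 2) *
    \sum_(n < N k) (pd k n)^-1 * sqnorm (grad (Q k n) (wko k)).

End ISFedAvg.

(* Main.v *)
(* The bound holds for every realisation of the agent and batch sampling, so
   taking expectations only uses that the sampling weights are probabilities.
   With [delta]-Lipschitz gradients, the distance [d_e] of the local iterate
   [w_{k,e}] from [w_{i-1}] obeys [d_{e+1} <= (1 + c_k delta A_k) d_e + mu X_k],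
   where [c_k] and [A_k] collect the step-size weights of agent [k] and [X_k] is
   affine in [|w_{i-1} - w_k^o|] and in the gradient norms at [w_k^o]; hence
   [d_e <= mu e (1 + c_k delta A_k)^e X_k]. Each gradient difference in [q_i] is
   at most [delta d_e], so [|q_i| <= mu Lambda (delta (|w~_{i-1}| + xi) + s)],
   where [s^2], the sum of the squared gradient norms at the local minimisers,
   is [O(sum_k sigma_{q,k}^2)]. Squaring with
   [(a + b + c)^2 <= 3 (a^2 + b^2 + c^2)] and using [mu^2 <= mu] concludes. *)

Require Import Defs.
From HB Require Import structures.
From mathcomp Require Import all_boot all_order all_algebra.
From mathcomp Require Import all_classical all_reals all_analysis.
From mathcomp Require Import ring lra.
Import Order.TTheory GRing.Theory Num.Theory.
Import numFieldNormedType.Exports.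
Local Open Scope ring_scope.

Lemma ler_sum_nneg_predT {R : numDomainType} {I : finType} (P : pred I) (F : I -> R) :
  (forall i, 0 <= F i) -> \sum_(i | P i) F i <= \sum_i F i.
Proof.
move=> F_ge0; rewrite [leRHS](bigID P) /= lerDl.
exact: sumr_ge0.
Qed.

Lemma ler_term_sum {R : numDomainType} {I : finType} (F : I -> R) (i : I) :
  (forall j, 0 <= F j) -> F i <= \sum_j F j.
Proof. by move=> F_ge0; rewrite (bigD1 i) //= lerDl sumr_ge0. Qed.

Lemma sqrrD3_le {R : realFieldType} (a b c : R) :
  (a + b + c) ^+ 2 <= 3 * (a ^+ 2 + b ^+ 2 + c ^+ 2).
Proof. by have := sqr_ge0 (a - b); have := sqr_ge0 (b - c); have := sqr_ge0 (a - c); nra. Qed.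

Lemma affine_recursion_le {R : realFieldType} (d : nat -> R) (a b : R) :
  1 <= a -> 0 <= b -> d 0%N <= 0 -> (forall e, d e.+1 <= a * d e + b) ->
  forall e, d e <= e%:R * a ^+ e * b.
Proof.
move=> a_ge1 b_ge0 d0 d_step; elim=> [|e IH]; first by rewrite !mul0r.
have h1 : a * d e <= a * (e%:R * a ^+ e * b) by rewrite ler_wpM2l // (le_trans ler01).
have h2 : b <= a ^+ e.+1 * b by rewrite ler_peMl // exprn_ege1.
apply: le_trans (d_step e) _; rewrite -addn1 natrD.
have -> : (e%:R + 1) * a ^+ (e + 1) * b = a * (e%:R * a ^+ e * b) + a ^+ e.+1 * b.
  by rewrite addn1 exprS; ring.
exact: lerD.
Qed.

Lemma ler_expect_affine {R : numDomainType} {I : finType} (w f g : I -> R) (a b : R) :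
  (forall i, 0 <= w i) -> \sum_i w i = 1 -> (forall i, f i <= a * g i + b) ->
  \sum_i w i * f i <= a * (\sum_i w i * g i) + b.
Proof.
move=> w_ge0 w_sum1 f_le.
have -> : a * (\sum_i w i * g i) + b = \sum_i w i * (a * g i + b).
  under [RHS]eq_bigr do rewrite mulrDr mulrCA.
  by rewrite big_split /= -mulr_sumr -mulr_suml w_sum1 mul1r.
by apply: ler_sum => i _; rewrite ler_wpM2l.
Qed.

Lemma bigA_distr_dffun {R : comNzRingType} {I : finType} {T_ : I -> finType}
    (f : forall i, T_ i -> R) :
  \prod_(i : I) \sum_(t : T_ i) f i t =
  \sum_(g : {dffun forall i : I, T_ i}) \prod_(i : I) f i (g i).
Proof.
rewrite (reindex (@dffun_of_fprod I T_)); last exact/onW_bij/dffun_of_fprod_bij.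
transitivity (\sum_(t : fprod T_) \prod_(i in I) [ffun x => f i x] (t i)); last first.
  by apply: eq_bigr => t _; apply: eq_bigr => i _; rewrite !ffunE.
rewrite (@big_fprod R 0 1 *%R +%R I T_ (fun i => [ffun x => f i x])).
rewrite -(bigA_distr_big_dep _ (fun i j => untag 0 [ffun x => f i x] j)).
apply: eq_bigr => i _; rewrite (@big_tag R 0 +%R I T_ f i).
by apply: eq_bigr => -[j t] _; rewrite /untag; case: eqP => // e; rewrite ffunE.
Qed.

Section EuclideanNorm.
Context {R : realType} {M : nat}.
Implicit Types u v w : 'rV[R]_M.

Lemma dotvC u v : dotv u v = dotv v u.
Proof. by apply: eq_bigr => j _; rewrite mulrC. Qed.

Lemma dotvDl u v w : dotv (u + v) w = dotv u w + dotv v w.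
Proof. by rewrite /dotv -big_split; apply: eq_bigr => j _; rewrite mxE mulrDl. Qed.

Lemma dotvDr u v w : dotv u (v + w) = dotv u v + dotv u w.
Proof. by rewrite dotvC dotvDl !(dotvC u). Qed.

Lemma dotvZl (a : R) u v : dotv (a *: u) v = a * dotv u v.
Proof. by rewrite /dotv mulr_sumr; apply: eq_bigr => j _; rewrite mxE mulrA. Qed.

Lemma dotvZr (a : R) u v : dotv u (a *: v) = a * dotv u v.
Proof. by rewrite dotvC dotvZl dotvC. Qed.

Lemma sqnorm_ge0 u : 0 <= sqnorm u.
Proof. by apply: sumr_ge0 => j _; rewrite -expr2 sqr_ge0. Qed.

Lemma sqnormD u v : sqnorm (u + v) = sqnorm u + 2 * dotv u v + sqnorm v.
Proof. by rewrite /sqnorm dotvDl !dotvDr (dotvC v u); ring. Qed.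

Lemma sqnormZ (a : R) u : sqnorm (a *: u) = a ^+ 2 * sqnorm u.
Proof. by rewrite /sqnorm dotvZl dotvZr mulrA expr2. Qed.

Lemma sqnorm_eq0_dotv u v : sqnorm u = 0 -> dotv u v = 0.
Proof.
move=> /eqP; rewrite psumr_eq0 => [/allP u0|j _]; last by rewrite -expr2 sqr_ge0.
apply: big1 => j _; have /implyP := u0 j (mem_index_enum j).
by rewrite -expr2 sqrf_eq0 => /(_ isT) /eqP ->; rewrite mul0r.
Qed.

Lemma enorm_ge0 u : 0 <= enorm u.
Proof. exact: sqrtr_ge0. Qed.

Lemma enorm_sqr u : enorm u ^+ 2 = sqnorm u.
Proof. by rewrite sqr_sqrtr // sqnorm_ge0. Qed.

Lemma enorm0 : enorm (0 : 'rV[R]_M) = 0.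
Proof. by rewrite /enorm /sqnorm /dotv big1 ?sqrtr0 // => j _; rewrite mxE mul0r. Qed.

(* Cauchy-Schwarz, from [0 <= | |v| u - |u| v |^2]. *)
Lemma dotv_le_enorm u v : dotv u v <= enorm u * enorm v.
Proof.
have [u0|u_neq0] := eqVneq (enorm u) 0.
  by rewrite sqnorm_eq0_dotv ?u0 ?mul0r // -enorm_sqr u0 expr0n.
have [v0|v_neq0] := eqVneq (enorm v) 0.
  by rewrite dotvC sqnorm_eq0_dotv ?v0 ?mulr0 // -enorm_sqr v0 expr0n.
have uv_gt0 : 0 < enorm u * enorm v by rewrite mulr_gt0 // lt0r ?u_neq0 ?v_neq0 enorm_ge0.
have := sqnorm_ge0 (enorm v *: u - enorm u *: v).
rewrite sqnormD -scaleNr !sqnormZ dotvZl dotvZr -!enorm_sqr sqrrN.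
set a := enorm u; set b := enorm v; set d := dotv u v => h.
suff : 0 <= (a * b) * (2 * (a * b - d)) by rewrite pmulr_rge0 // pmulr_rge0 // subr_ge0.
by move: h; congr (_ <= _); ring.
Qed.

Lemma enormD u v : enorm (u + v) <= enorm u + enorm v.
Proof.
rewrite -(ler_pXn2r (n := 2)) ?nnegrE ?addr_ge0 ?enorm_ge0 //.
rewrite enorm_sqr sqnormD sqrrD !enorm_sqr lerD2r lerD2l.
by rewrite mulr_natl !mulr2n lerD ?dotv_le_enorm.
Qed.

Lemma enormZ (a : R) u : enorm (a *: u) = `|a| * enorm u.
Proof. by rewrite /enorm sqnormZ sqrtrM ?sqr_ge0 // sqrtr_sqr. Qed.

Lemma enormN u : enorm (- u) = enorm u.
Proof. by rewrite -scaleN1r enormZ normrN normr1 mul1r. Qed.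

Lemma enormB u v : enorm (u - v) = enorm (v - u).
Proof. by rewrite -enormN opprB. Qed.

Lemma enorm_sum {I : finType} (P : pred I) (f : I -> 'rV[R]_M) :
  enorm (\sum_(i | P i) f i) <= \sum_(i | P i) enorm (f i).
Proof.
elim/big_ind2: _ => [|x1 x2 y1 y2 h1 h2|//]; first by rewrite enorm0.
exact: le_trans (enormD _ _) (lerD h1 h2).
Qed.

End EuclideanNorm.

Section IncrementalNoise.
Variables (R : realType) (K : nat) (N E B : 'I_K -> nat)
  (p : 'I_K -> R) (pd : forall k : 'I_K, 'I_(N k) -> R) (delta : R).
Hypotheses (p_ge0 : forall k, 0 <= p k) (pd_gt0 : forall k n, 0 < pd k n)
  (delta_ge0 : 0 <= delta).

Local Ltac nonneg := repeat match goal with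
  | |- is_true (0 <= _) => assumption
  | |- is_true (0 <= _ * _) => apply: mulr_ge0
  | |- is_true (0 <= _ + _) => apply: addr_ge0
  | |- is_true (0 <= _ ^+ 2) => apply: sqr_ge0
  | |- is_true (0 <= _ ^+ _) => apply: exprn_ge0
  | |- is_true (0 <= _%:R) => apply: ler0n
  end.

Definition agent_scale k := (K%:R * p k * (E k)%:R * (B k)%:R)^-1.
Definition data_scale k (n : 'I_(N k)) := ((N k)%:R * pd k n)^-1.
Definition data_mass k := \sum_(n < N k) data_scale k n.
Definition local_growth k := 1 + agent_scale k * delta * data_mass k.
Definition local_gain k := (E k)%:R * local_growth k ^+ E k.
Definition agent_gain k :=
  agent_scale k * (E k)%:R * data_mass k * delta * local_gain k.
Definition noise_gain (L : nat) :=
  L%:R^-1 * \sum_k agent_gain k * (agent_scale k * data_mass k).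
Definition sample_mass : R := \sum_k (B k)%:R * (N k)%:R ^+ 2.
Definition noise_const L :=
  3 * noise_gain L ^+ 2 * (delta ^+ 2 + sample_mass * K%:R).

Lemma agent_scale_ge0 k : 0 <= agent_scale k.
Proof. by rewrite invr_ge0 !mulr_ge0. Qed.

Lemma data_scale_ge0 k n : 0 <= data_scale k n.
Proof. by rewrite invr_ge0 mulr_ge0 // ltW. Qed.

Lemma data_mass_ge0 k : 0 <= data_mass k.
Proof. by apply: sumr_ge0 => n _; apply: data_scale_ge0. Qed.

Lemma local_growth_ge1 k : 1 <= local_growth k.
Proof. by rewrite lerDl !mulr_ge0 ?agent_scale_ge0 ?data_mass_ge0. Qed.

Lemma local_gain_ge0 k : 0 <= local_gain k.
Proof. by rewrite mulr_ge0 ?exprn_ge0 // (le_trans ler01 (local_growth_ge1 k)). Qed.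

Lemma agent_gain_ge0 k : 0 <= agent_gain k.
Proof.
by rewrite /agent_gain; nonneg; rewrite ?agent_scale_ge0 ?data_mass_ge0 ?local_gain_ge0.
Qed.

Lemma noise_gain_ge0 L : 0 <= noise_gain L.
Proof.
rewrite mulr_ge0 ?invr_ge0 // sumr_ge0 // => k _.
by nonneg; rewrite ?agent_gain_ge0 ?agent_scale_ge0 ?data_mass_ge0.
Qed.

Variables (M : nat) (Q : forall k : 'I_K, 'I_(N k) -> 'rV[R]_M -> R)
  (wko : 'I_K -> 'rV[R]_M) (mu : R).
Hypotheses (mu_ge0 : 0 <= mu) (mu_le1 : mu <= 1)
  (grad_lipschitz : forall k n x y,
     enorm (grad (Q k n) x - grad (Q k n) y) <= delta * enorm (x - y)).

Definition opt_grad k n := enorm (grad (Q k n) (wko k)).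
(* [mu * drift w k] bounds the first local step of agent [k] from [w]. *)
Definition drift w k := agent_scale k *
  (delta * data_mass k * enorm (w - wko k) + \sum_n data_scale k n * opt_grad k n).

Lemma drift_ge0 w k : 0 <= drift w k.
Proof.
rewrite mulr_ge0 ?agent_scale_ge0 // addr_ge0 ?mulr_ge0 ?data_mass_ge0 ?enorm_ge0 //.
by rewrite sumr_ge0 // => n _; rewrite mulr_ge0 ?data_scale_ge0 ?enorm_ge0.
Qed.

Lemma enorm_grad_le k n x :
  enorm (grad (Q k n) x) <= delta * enorm (x - wko k) + opt_grad k n.
Proof.
rewrite -(subrK (grad (Q k n) (wko k)) (grad (Q k n) x)).
exact: le_trans (enormD _ _) (lerD (grad_lipschitz _ _ _ _) (lexx _)).
Qed.

Lemma enorm_batch_grad_le k (T : {set 'I_(N k)}) x :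
  enorm (\sum_(b in T) data_scale k b *: grad (Q k b) x)
  <= delta * data_mass k * enorm (x - wko k) + \sum_n data_scale k n * opt_grad k n.
Proof.
apply: le_trans (enorm_sum _ _) _.
apply: le_trans (ler_sum_nneg_predT _ _ (fun n => enorm_ge0 _)) _.
rewrite /data_mass mulr_sumr mulr_suml -big_split /=.
apply: ler_sum => n _; rewrite enormZ ger0_norm ?data_scale_ge0 //.
apply: le_trans (ler_wpM2l (data_scale_ge0 _ _) (enorm_grad_le _ _ _)) _.
lra.
Qed.

Lemma local_iter_step_le k w (bs : {ffun 'I_(E k) -> {set 'I_(N k)}}) e :
  enorm (local_iter B Q p pd mu w bs e.+1 - w)
  <= local_growth k * enorm (local_iter B Q p pd mu w bs e - w) + mu * drift w k.
Proof.
rewrite [local_iter _ _ _ _ _ _ _ e.+1]/=.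
set we := local_iter B Q p pd mu w bs e.
set d := enorm (we - w); set r := enorm (w - wko k).
set G := \sum_n data_scale k n * opt_grad k n.
have batch_le := enorm_batch_grad_le k (batch_at bs e) we.
have dist_le : enorm (we - wko k) <= d + r by rewrite -[we](subrK w) -addrA enormD.
have c_ge0 := agent_scale_ge0 k; have A_ge0 := data_mass_ge0 k.
have step_le : mu * agent_scale k * enorm (\sum_(b in batch_at bs e)
      data_scale k b *: grad (Q k b) we)
    <= mu * agent_scale k * (delta * data_mass k * (d + r) + G).
  rewrite ler_wpM2l ?mulr_ge0 //; apply: le_trans batch_le _.
  by rewrite lerD2r ler_wpM2l ?mulr_ge0.
have mu_shrink : mu * (agent_scale k * delta * data_mass k * d)
    <= agent_scale k * delta * data_mass k * d.
  by rewrite ler_piMl ?mulr_ge0 ?enorm_ge0.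
set S := \sum_(b in _) _.
have -> : we - (mu * agent_scale k) *: S - w = (we - w) - (mu * agent_scale k) *: S.
  by rewrite addrAC.
apply: le_trans (enormD _ _) _.
rewrite enormN enormZ ger0_norm ?mulr_ge0 // -/d.
rewrite /local_growth /drift -/r -/G; lra.
Qed.

Lemma local_iter_drift_le k w (bs : {ffun 'I_(E k) -> {set 'I_(N k)}}) e :
  (e < E k)%N ->
  enorm (local_iter B Q p pd mu w bs e - w) <= local_gain k * (mu * drift w k).
Proof.
move=> lt_e_E; have growth_ge1 := local_growth_ge1 k.
have b_ge0 : 0 <= mu * drift w k by rewrite mulr_ge0 ?drift_ge0.
apply: le_trans (@affine_recursion_le _
  (fun e => enorm (local_iter B Q p pd mu w bs e - w)) _ _ growth_ge1 b_ge0 _ _ e) _.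
- by rewrite /= subrr enorm0.
- exact: local_iter_step_le.
rewrite ler_wpM2r // ler_pM ?ler0n ?exprn_ge0 ?(le_trans ler01) //.
  by rewrite ler_nat ltnW.
by rewrite ler_weXn2l // ltnW.
Qed.

Lemma enorm_local_grad_change_le k w (bs : {ffun 'I_(E k) -> {set 'I_(N k)}}) :
  enorm (\sum_(e < E k) \sum_(b in bs e) data_scale k b *:
           (grad (Q k b) (local_iter B Q p pd mu w bs e) - grad (Q k b) w))
  <= mu * ((E k)%:R * data_mass k * delta * local_gain k) * drift w k.
Proof.
set D := data_mass k * (delta * (local_gain k * (mu * drift w k))).
apply: le_trans (enorm_sum _ _) _.
apply: (@le_trans _ _ (\sum_(e < E k) D)); last first.
  by rewrite sumr_const card_ord -mulr_natl /D; lra.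
apply: ler_sum => e _.
apply: le_trans (enorm_sum _ _) _.
apply: le_trans (ler_sum_nneg_predT _ _ (fun n => enorm_ge0 _)) _.
rewrite /D /data_mass mulr_suml; apply: ler_sum => b _.
rewrite enormZ ger0_norm ?data_scale_ge0 // ler_wpM2l ?data_scale_ge0 //.
apply: le_trans (grad_lipschitz _ _ _ _) _.
by rewrite ler_wpM2l // local_iter_drift_le.
Qed.

Lemma enorm_incr_noise_le L w S
    (bb : {dffun forall k : 'I_K, {ffun 'I_(E k) -> {set 'I_(N k)}}}) :
  enorm (incr_noise L B Q p pd mu w S bb)
  <= mu * (L%:R^-1 * \sum_k agent_gain k * drift w k).
Proof.
rewrite /incr_noise enormZ ger0_norm ?invr_ge0 // mulrCA ler_wpM2l ?invr_ge0 //.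
apply: le_trans (enorm_sum _ _) _.
apply: le_trans (ler_sum_nneg_predT _ _ (fun n => enorm_ge0 _)) _.
rewrite mulr_sumr; apply: ler_sum => k _.
rewrite enormZ ger0_norm; last by rewrite -/(agent_scale k) agent_scale_ge0.
apply: le_trans (ler_wpM2l (agent_scale_ge0 k) (enorm_local_grad_change_le k w (bb k))) _.
by rewrite /agent_gain; lra.
Qed.

Definition opt_grad_mass := \sum_k \sum_(n < N k) opt_grad k n ^+ 2.

Lemma opt_grad_mass_ge0 : 0 <= opt_grad_mass.
Proof. by apply: sumr_ge0 => k _; apply: sumr_ge0 => n _; apply: sqr_ge0. Qed.

Lemma opt_grad_le_sqrt k n : opt_grad k n <= Num.sqrt opt_grad_mass.
Proof.
rewrite -[opt_grad k n]ger0_norm ?enorm_ge0 // -sqrtr_sqr ler_sqrt ?opt_grad_mass_ge0 //.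
apply: le_trans (@ler_term_sum _ _ (fun m => opt_grad k m ^+ 2) n _) _.
  by move=> m; apply: sqr_ge0.
apply: (@ler_term_sum _ _ (fun j => \sum_m opt_grad j m ^+ 2)) => j.
by apply: sumr_ge0 => m _; apply: sqr_ge0.
Qed.

Lemma drift_le wo xi (wko_near : forall k, enorm (wko k - wo) <= xi) w k :
  drift w k <= agent_scale k * data_mass k *
    (delta * (enorm (wo - w) + xi) + Num.sqrt opt_grad_mass).
Proof.
have dist_le : enorm (w - wko k) <= enorm (wo - w) + xi.
  have -> : w - wko k = (w - wo) + (wo - wko k) by rewrite addrA subrK.
  by apply: le_trans (enormD _ _) _; rewrite enormB lerD2l enormB wko_near.
have grad_sum_le : \sum_n data_scale k n * opt_grad k n
    <= data_mass k * Num.sqrt opt_grad_mass.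
  rewrite /data_mass mulr_suml; apply: ler_sum => n _.
  by rewrite ler_wpM2l ?data_scale_ge0 ?opt_grad_le_sqrt.
have := ler_wpM2l (mulr_ge0 delta_ge0 (data_mass_ge0 k)) dist_le.
rewrite /drift -[agent_scale k * _ * _]mulrA => scaled_dist_le.
by rewrite ler_wpM2l ?agent_scale_ge0 //; lra.
Qed.

Lemma enorm_incr_noise_le_gain L wo xi
    (wko_near : forall k, enorm (wko k - wo) <= xi) w S
    (bb : {dffun forall k : 'I_K, {ffun 'I_(E k) -> {set 'I_(N k)}}}) :
  enorm (incr_noise L B Q p pd mu w S bb)
  <= mu * noise_gain L * (delta * (enorm (wo - w) + xi) + Num.sqrt opt_grad_mass).
Proof.
set V := _ + Num.sqrt _.
have -> : mu * noise_gain L * V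
    = mu * (L%:R^-1 * \sum_k agent_gain k * (agent_scale k * data_mass k * V)).
  rewrite /noise_gain -mulrA -mulrA mulr_suml.
  by congr (_ * (_ * _)); apply: eq_bigr => k _; ring.
apply: le_trans (enorm_incr_noise_le L w S bb) _.
rewrite ler_wpM2l // ler_wpM2l ?invr_ge0 //.
apply: ler_sum => k _; rewrite ler_wpM2l ?agent_gain_ge0 //.
exact: drift_le.
Qed.

Hypotheses (pd_sum1 : forall k, \sum_(n < N k) pd k n = 1)
  (B_gt0 : forall k, (0 < B k <= N k)%N).

Lemma sigma_q2_ge0 k : 0 <= sigma_q2 B Q pd wko k.
Proof.
rewrite /sigma_q2; apply: mulr_ge0; first by rewrite divr_ge0 ?mulr_ge0 ?exprn_ge0.
by apply: sumr_ge0 => n _; rewrite mulr_ge0 ?sqnorm_ge0 // invr_ge0 ltW.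
Qed.

Lemma sum_sqr_opt_grad_le k :
  \sum_n opt_grad k n ^+ 2 <= (B k)%:R * (N k)%:R ^+ 2 * sigma_q2 B Q pd wko k.
Proof.
have /andP[B_gt0k B_le_N] := B_gt0 k.
have BN_gt0 : 0 < (B k)%:R * (N k)%:R ^+ 2 :> R.
  by rewrite mulr_gt0 ?exprn_gt0 ?ltr0n // (leq_trans B_gt0k).
rewrite /sigma_q2 mulrA mulrCA mulfV ?gt_eqF // mulr1.
set P := \sum_n (pd k n)^-1 * _; have P_ge0 : 0 <= P.
  by apply: sumr_ge0 => n _; rewrite mulr_ge0 ?sqnorm_ge0 // invr_ge0 ltW.
apply: (@le_trans _ _ P); last by rewrite ler_peMl // ler1n.
apply: ler_sum => n _; rewrite /opt_grad enorm_sqr ler_peMl ?sqnorm_ge0 //.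
rewrite invf_ge1 // -(pd_sum1 k).
by apply: (@ler_term_sum _ _ (pd k)) => m; rewrite ltW.
Qed.

Lemma opt_grad_mass_le : opt_grad_mass <= sample_mass * \sum_k sigma_q2 B Q pd wko k.
Proof.
rewrite mulr_sumr; apply: ler_sum => k _.
apply: le_trans (sum_sqr_opt_grad_le k) _; rewrite ler_wpM2r ?sigma_q2_ge0 //.
by apply: (@ler_term_sum _ _ (fun j => (B j)%:R * (N j)%:R ^+ 2)) => j; rewrite mulr_ge0.
Qed.

Lemma sqnorm_incr_noise_le (K_gt0 : (0 < K)%N) L wo xi
    (wko_near : forall k, enorm (wko k - wo) <= xi) w S
    (bb : {dffun forall k : 'I_K, {ffun 'I_(E k) -> {set 'I_(N k)}}}) :
  sqnorm (incr_noise L B Q p pd mu w S bb)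
  <= noise_const L * mu * sqnorm (wo - w) + noise_const L * mu * xi ^+ 2
     + noise_const L * mu ^+ 2 * (K%:R^-1 * \sum_k sigma_q2 B Q pd wko k).
Proof.
have q_le := enorm_incr_noise_le_gain L wo xi wko_near w S bb.
rewrite -enorm_sqr -(enorm_sqr (wo - w)).
set q := enorm _ in q_le *; set r := enorm (wo - w) in q_le *.
set s := Num.sqrt _ in q_le; set avg := K%:R^-1 * _.
have avg_ge0 : 0 <= avg by rewrite mulr_ge0 ?invr_ge0 // sumr_ge0 // => k _; apply: sigma_q2_ge0.
have s_sqr_le : s ^+ 2 <= sample_mass * K%:R * avg.
  rewrite sqr_sqrtr ?opt_grad_mass_ge0 // -mulrA mulVKf ?pnatr_eq0 -?lt0n //.
  exact: opt_grad_mass_le.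
have q_sqr_le : q ^+ 2 <= mu ^+ 2 * noise_gain L ^+ 2 * (delta * r + delta * xi + s) ^+ 2.
  have -> : mu ^+ 2 * noise_gain L ^+ 2 * (delta * r + delta * xi + s) ^+ 2
      = (mu * noise_gain L * (delta * (r + xi) + s)) ^+ 2 by ring.
  by rewrite !expr2 ler_pM ?enorm_ge0.
set Z := sample_mass * K%:R in s_sqr_le *.
have W_le : (delta * r + delta * xi + s) ^+ 2
    <= 3 * (delta ^+ 2 * r ^+ 2 + delta ^+ 2 * xi ^+ 2 + Z * avg).
  apply: le_trans (sqrrD3_le _ _ _) _.
  by rewrite ler_pM2l // !exprMn lerD2l.
have Z_ge0 : 0 <= Z by rewrite mulr_ge0 // sumr_ge0 // => k _; nonneg.
apply: le_trans q_sqr_le _; apply: le_trans (ler_wpM2l _ W_le) _; first by rewrite mulr_ge0 ?sqr_ge0.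
rewrite /noise_const -/Z -subr_ge0.
set G := noise_gain L; have G_ge0 : 0 <= G := noise_gain_ge0 L.
have one_sub_mu_ge0 : 0 <= 1 - mu by rewrite subr_ge0.
have -> : 3 * G ^+ 2 * (delta ^+ 2 + Z) * mu * r ^+ 2
    + 3 * G ^+ 2 * (delta ^+ 2 + Z) * mu * xi ^+ 2
    + 3 * G ^+ 2 * (delta ^+ 2 + Z) * mu ^+ 2 * avg
    - mu ^+ 2 * G ^+ 2 * (3 * (delta ^+ 2 * r ^+ 2 + delta ^+ 2 * xi ^+ 2 + Z * avg))
  = 3 * G ^+ 2 * mu * (r ^+ 2 + xi ^+ 2) * (delta ^+ 2 * (1 - mu) + Z)
    + 3 * G ^+ 2 * delta ^+ 2 * mu ^+ 2 * avg by ring.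
by nonneg.
Qed.
End IncrementalNoise.

Section IterExpectation.
Variables (R : realType) (K : nat) (N E : 'I_K -> nat)
  (piA : {set 'I_K} -> R) (piB : forall k : 'I_K, {set 'I_(N k)} -> R).
Hypotheses (piA_ge0 : forall S, 0 <= piA S) (piA_sum1 : \sum_S piA S = 1)
  (piB_ge0 : forall k T, 0 <= piB k T) (piB_sum1 : forall k, \sum_T piB k T = 1).

Lemma batch_weight_sum1 :
  \sum_(bb : {dffun forall k : 'I_K, {ffun 'I_(E k) -> {set 'I_(N k)}}})
     \prod_(k < K) \prod_(e < E k) piB k (bb k e) = 1.
Proof.
rewrite -(@bigA_distr_dffun _ _ (fun k => {ffun 'I_(E k) -> {set 'I_(N k)}} : finType)
            (fun k h => \prod_(e < E k) piB k (h e))).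
apply: big1 => k _.
transitivity (\prod_(e < E k) \sum_(T : {set 'I_(N k)}) piB k T).
  by rewrite bigA_distr_bigA.
by apply: big1 => e _; apply: piB_sum1.
Qed.

Lemma iter_expect_le F U : (forall S bb, F S bb <= U) ->
  iter_expect (E := E) piA piB F <= U.
Proof.
move=> F_le; rewrite /iter_expect.
apply: (@le_trans _ _ (\sum_S piA S * U)); last by rewrite -mulr_suml piA_sum1 mul1r.
apply: ler_sum => S _.
rewrite -[leRHS]mulr1 -[X in _ * X]batch_weight_sum1 mulr_sumr.
apply: ler_sum => bb _; rewrite [leRHS]mulrAC ler_wpM2l // mulr_ge0 //.
by apply: prodr_ge0 => k _; apply: prodr_ge0 => e _.
Qed.
End IterExpectation.

Theorem lemma5 (R : realType)
  (K L : nat) (N E B : 'I_K -> nat)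
  (p : 'I_K -> R) (pd : forall k : 'I_K, 'I_(N k) -> R)
  (nu delta : R) :
  (0 < L <= K)%N ->
  (forall k, 0 < E k)%N ->
  (forall k, 0 < B k <= N k)%N ->
  (forall k, 0 < p k) -> \sum_(k < K) p k = 1 ->
  (forall k n, 0 < pd k n) -> (forall k, \sum_(n < N k) pd k n = 1) ->
  0 < nu -> 0 < delta ->
  exists (C mu0 : R), 0 < mu0 /\
  forall (M : nat)
    (Q : forall k : 'I_K, 'I_(N k) -> 'rV[R]_M -> R)
    (wo : 'rV[R]_M) (wko : 'I_K -> 'rV[R]_M) (xi : R)
    (piA : {set 'I_K} -> R) (piB : forall k : 'I_K, {set 'I_(N k)} -> R)
    (Omega : finType) (piW : Omega -> R) (wprev : Omega -> 'rV[R]_M)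
    (mu : R),
    (* Assumption A *)
    (forall k n w, differentiable (Q k n) w) ->
    (forall k n, convex_fun (Q k n)) ->
    (forall k n x y,
        enorm (grad (Q k n) x - grad (Q k n) y) <= delta * enorm (x - y)) ->
    (forall k, strongly_convex nu (emp_risk Q k)) ->
    (* minimizers *)
    (forall w, agg_risk Q wo <= agg_risk Q w) ->
    (forall k w, emp_risk Q k (wko k) <= emp_risk Q k w) ->
    (* Assumption B *)
    (forall k, enorm (wko k - wo) <= xi) ->
    (* sampling without replacement with the prescribed inclusion probabilities *)
    sampling_design L p piA ->
    (forall k, sampling_design (B k) (pd k) (piB k)) ->
    (* distribution of the previous iterate w_{i-1} *)
    (forall o, 0 <= piW o) -> \sum_(o : Omega) piW o = 1 ->
    0 < mu <= mu0 ->
    \sum_(o : Omega) piW o *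
       iter_expect (E := E) piA piB
         (fun S bb => sqnorm (incr_noise L B Q p pd mu (wprev o) S bb))
    <= C * mu * (\sum_(o : Omega) piW o * sqnorm (wo - wprev o))
       + C * mu * xi ^+ 2
       + C * mu ^+ 2 * (K%:R^-1 * \sum_(k < K) sigma_q2 B Q pd wko k).
Proof.
move=> /andP[L_gt0 L_le_K] _ B_gt0 p_gt0 _ pd_gt0 pd_sum1 _ delta_gt0.
have K_gt0 := leq_trans L_gt0 L_le_K; have delta_ge0 := ltW delta_gt0.
have p_ge0 k : 0 <= p k := ltW (p_gt0 k).
exists (noise_const R K N E B p pd delta L), 1.
split=> [|M Q wo wko xi piA piB Omega piW wprev mu]; first exact: ltr01.
move=> _ _ grad_lipschitz _ _ _ wko_near [piA_ge0 piA_sum1 _ _] piB_design.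
move=> piW_ge0 piW_sum1 /andP[/ltW mu_ge0 mu_le1].
have piB_ge0 k T : 0 <= piB k T by case: (piB_design k).
have piB_sum1 k : \sum_T piB k T = 1 by case: (piB_design k).
rewrite -addrA; apply: ler_expect_affine => // o.
apply: iter_expect_le => // S bb; rewrite addrA.
exact: sqnorm_incr_noise_le.
Qed.
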